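(* Let $n>1$ and let $\beta_i$ be the $i$th largest eigenvalue of the adjacency matrix $A(\mathcal{S}_n/\pi)$, with $1\leq i\leq 5$. Then $\beta_i\in(n-i,\,n-i+1]$.
   Context: Here $n$ is an integer and $A(\mathcal{S}_n/\pi)$ is the tridiagonal $(n+1)\times(n+1)$ real matrix with entries $A_{k,k}=n-k$ for $1\leq k\leq n$, $A_{n+1,n+1}=0$, $A_{k,k+1}=1$ and $A_{k+1,k}=k$ for $1\leq k\leq n$, and all other entries $0$. It is the adjacency matrix of the quotient (directed multigraph) $\mathcal{S}_n/\pi$, where $\mathcal{S}_n=\mathcal{R}(K_{1,n})$ is the 1-skeleton of the stellohedron, i.e. the rotation graph of the star $K_{1,n}$ with $n$ leaves: its vertices are the search trees on $K_{1,n}$ (rooted trees obtained by choosing a root vertex $r$ and recursively attaching to $r$ search trees on the connected components of $K_{1,n}-r$), and two search trees are adjacent if they differ by a single rotation. Every such search tree is a broom, and $\pi=C_1,\ldots,C_{n+1}$ is the equitable partition in which $C_j=N_{n-j+1}$, where $N_k$ is the set of brooms with handle of length $k$ (exactly $k$ leaves of the star are ancestors of the center of the star). The entry $(j,l)$ of $A(\mathcal{S}_n/\pi)$ is the number of neighbors in $C_l$ of any vertex of $C_j$. The matrix is similar to a real symmetric matrix, so all its eigenvalues are real; they are ordered decreasingly.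
   Formalization: The claim is proved for i ≤ n+1 (so that β_i exists) and with the pairs (n,i) = (2,3), (3,4), (4,4), (4,5), (5,5) excluded, where it is false: for n=2, for example, β_3 = (−1−√5)/2 is not in (−1,0]. *)

(* Defs.v *)
From HB Require Import structures.
From mathcomp Require Import all_boot all_order all_algebra.
From mathcomp.real_closed Require Import polyrcf.

Set Implicit Arguments.
Unset Strict Implicit.
Unset Printing Implicit Defensive.

Import Order.TTheory GRing.Theory Num.Theory.
Local Open Scope ring_scope.

(* The adjacency matrix of the quotient of the 1-skeleton of the n-dimensional
   stellohedron by the partition N_n, ..., N_0 of the brooms according to the
   length of their handle.  Ordinals start at 0, so row [j] and column [l] are
   the 1-based row j + 1 and column l + 1; in particular the subdiagonal entry
   (k + 1, k) = k is read with k = l + 1. *)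
Definition stello_quotient_mx (R : pzRingType) (n : nat) : 'M[R]_n.+1 :=
  \matrix_(j < n.+1, l < n.+1)
    if l == j :> nat then (if (j < n)%N then n%:R - j.+1%:R else 0)
    else if l == j.+1 :> nat then 1
    else if j == l.+1 :> nat then l.+1%:R
    else 0.

(* [rootsR] lists each real root of the characteristic polynomial once, so the
   algebraic multiplicities are restored with [nseq].  When all the eigenvalues
   are real, as for [stello_quotient_mx], this is the whole spectrum. *)
Definition eigenvalues (R : rcfType) (m : nat) (A : 'M[R]_m) : seq R :=
  sort >=%R
    (flatten [seq nseq (mup x (char_poly A)) x | x <- rootsR (char_poly A)]).

(* Counting starts at i = 1; the value is 0 when there is no such eigenvalue. *)
Definition nth_largest_eigenvalue (R : rcfType) (m : nat) (A : 'M[R]_m)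
  (i : nat) : R := (eigenvalues A)`_i.-1.

(* Main.v *)
Require Import Defs.
From HB Require Import structures.
From mathcomp Require Import all_boot all_order all_algebra.
From mathcomp.real_closed Require Import polyrcf.
From mathcomp Require Import ring lra zify.

Set Implicit Arguments.
Unset Strict Implicit.
Unset Printing Implicit Defensive.

Import Order.TTheory GRing.Theory Num.Theory.
Local Open Scope ring_scope.

(** Write the candidate eigenvalues of the quotient matrix A as n - t and solve
    A v = (n - t) v row by row, starting from v_0 = 1.  Then n cancels: up to
    sign, the entries of v are the values at t of the monic Charlier polynomials
    C_0, C_1, ... with parameter 1 (the orthogonal polynomials of the Poisson
    distribution of mean 1).  Only the last row of A is different, and it asks
    for C_(n+1)(t) + C_n(t) = 0.  The generating function
    of these polynomials is exp(-w) (1 + w)^t, from which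
    C_(n+1)(t) + C_n(t) = t C_n(t - 1).  So the spectrum of A consists of n
    and of the numbers n - 1 - s, where s runs over the zeros of C_n
    ([stello_quotient_spectrum]); no determinant has to be computed.

    It remains to place the first four zeros s_0 < s_1 < ... of C_n: the
    theorem says that s_k lies in ]k, k + 1[.

    The lower bound comes for free.  The zeros of C_n are positive and more
    than 1 apart, because the identity above lets this property pass from C_n
    to C_(n+1) by the intermediate value theorem ([charlier_roots]).

    For the upper bound, the values C_n(0), C_n(1), ..., C_n(4) alternate in
    sign as soon as n is large enough ([charlier_sign_change]), so that there
    is a zero in each interval ]k, k + 1[, and by the spacing the zeros found
    in this way are the smallest ones ([spaced_root_in]).  For k = 0, 1, 2, 3
    the value at k + 1 has the right sign from n = 2, 3, 5, 6 on.  The zero s_k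
    belongs to the eigenvalue of index i = k + 2, so the n >= k + 1 below these
    thresholds give the excluded pairs (n, i): n = 2 for i = 3, n = 3, 4 for
    i = 4, and n = 4, 5 for i = 5. *)

(** * Charlier polynomials *)

(** The monic Charlier polynomials with parameter 1.  The usual definition is
    the recurrence [charlier_three_term]; the one chosen here is the
    identity on which both the spectrum and the spacing of the zeros rest. *)
Fixpoint charlier (R : comNzRingType) (n : nat) : {poly R} :=
  if n is m.+1 then 'X * (charlier R m \Po ('X - 1)) - charlier R m else 1.

Lemma hornerS_charlier (R : comNzRingType) n (t : R) :
  (charlier R n.+1).[t] = t * (charlier R n).[t - 1] - (charlier R n).[t].
Proof. by rewrite /= !hornerE horner_comp !hornerE. Qed.

(** In terms of the generating function: the one at t is 1 + w times the one at
    t - 1.  At n = 0 the index n.-1 is a dummy, its factor being 0. *)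
Lemma charlier_shift (R : comNzRingType) n (t : R) :
  (charlier R n).[t] =
    (charlier R n).[t - 1] + n%:R * (charlier R n.-1).[t - 1].
Proof.
elim: n t => [|n IHn] t; first by rewrite /= !hornerE.
rewrite /= !hornerS_charlier.
have rec_n : n%:R * ((t - 1) * (charlier R n.-1).[t - 1 - 1]
    - (charlier R n.-1).[t - 1]) = n%:R * (charlier R n).[t - 1].
  by case: n {IHn} => [|n]; rewrite ?mul0r //= hornerS_charlier.
rewrite (IHn t) -natr1.
have -> : (charlier R n).[t - 1 - 1] =
    (charlier R n).[t - 1] - n%:R * (charlier R n.-1).[t - 1 - 1].
  by rewrite (IHn (t - 1)) addrK.
rewrite (mulrDl n%:R) -rec_n; ring.
Qed.

Lemma charlier_three_term (R : comNzRingType) n (t : R) :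
  (charlier R n.+1).[t] =
    (t - n.+1%:R) * (charlier R n).[t] - n%:R * (charlier R n.-1).[t].
Proof.
rewrite hornerS_charlier -natr1.
have -> : (charlier R n).[t - 1] =
    (charlier R n).[t] - n%:R * (charlier R n.-1).[t - 1].
  by rewrite [X in _ = X - _]charlier_shift addrK.
have step : n%:R * (t * (charlier R n.-1).[t - 1]) =
    n%:R * ((charlier R n).[t] + (charlier R n.-1).[t]).
  by case: n => [|n]; rewrite ?mul0r //= hornerS_charlier subrK.
by rewrite mulrBr mulrCA step; ring.
Qed.

Lemma charlier_monic_size (R : idomainType) n :
  (charlier R n \is monic) /\ size (charlier R n) = n.+1.
Proof.
elim: n => [|n [mon_n size_n]] /=; first by rewrite monic1 size_poly1.
have size_X1 : size ('X - 1 : {poly R}) = 2%N by rewrite -polyC1 size_XsubC.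
set p := _ \Po _.
have size_p : size p = n.+1 by rewrite size_comp_poly2.
have mon_p : p \is monic.
  rewrite monicE lead_coef_comp ?size_X1 // (monicP mon_n) mul1r.
  by rewrite -polyC1 lead_coefXsubC expr1n.
have size_Xp : size ('X * p) = n.+2.
  by rewrite mulrC size_mulX ?size_p // monic_neq0.
split; last by rewrite size_polyDl ?size_polyN ?size_n size_Xp.
rewrite monicE lead_coefDl ?size_polyN ?size_n ?size_Xp //.
by rewrite mulrC lead_coefMX -monicE.
Qed.

(** * Spacing of the zeros *)

Definition gap {R : realFieldType} : rel R := fun x y => x + 1 < y.

Lemma gap_lt (R : realFieldType) (x y : R) : gap x y -> x < y.
Proof. by rewrite /gap; lra. Qed.

Lemma gap_path_nth_gt (R : realFieldType) (x : R) s j :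
  path gap x s -> (j < size s)%N -> x + j.+1%:R < nth 0 s j.
Proof.
elim: s x j => [|y s IHs] x [|j] //= /andP[xy path_s] lt_j; first by [].
have := IHs y j path_s lt_j; move: xy; rewrite /gap -(natr1 j.+1); lra.
Qed.

Lemma gap_path_mono (R : realFieldType) (x : R) s i j :
  path gap x s -> (i <= j <= size s)%N -> nth 0 (x :: s) i <= nth 0 (x :: s) j.
Proof.
move=> path_s /andP[le_ij le_j].
have le_s : sorted <=%R (x :: s).
  by apply: sub_path path_s => u v /gap_lt/ltW.
by apply: (sorted_leq_nth le_trans lexx) => //; rewrite inE /= ltnS //; lia.
Qed.

Lemma gap_path_cut (R : realFieldType) (x : R) s i a :
    path gap x s -> (i < size s)%N -> a \in s ->
  a <= nth 0 (x :: s) i \/ nth 0 s i <= a.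
Proof.
move=> path_s lt_i /(nthP 0)[k lt_k <-].
case: (ltnP k i) => [lt_ki|le_ik]; [left|right].
  by apply: (@gap_path_mono _ x s k.+1 i); rewrite // lt_ki ltnW.
by apply: (@gap_path_mono _ x s i.+1 k.+1); rewrite // ltnS le_ik.
Qed.

Lemma le_last_gap_path (R : realFieldType) (x : R) s a :
  path gap x s -> a \in s -> a <= last x s.
Proof.
move=> path_s /(nthP 0)[i lt_i <-]; rewrite (last_nth 0).
by apply: (@gap_path_mono _ x s i.+1 (size s)); rewrite // lt_i leqnn.
Qed.

(** Sign changes of q between u + 1 and v, for consecutive terms u, v of a
    spaced sequence, give zeros that are themselves spaced: the zero after v is
    beyond v + 1, the zero before v is below v. *)
Lemma spaced_roots (R : rcfType) (q : {poly R}) (a b : R) t :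
    b <= a -> path (fun x y => gap x y && (q.[x + 1] * q.[y] < 0)) a t ->
  exists r, [/\ size r = size t, path gap b r & all (root q) r].
Proof.
elim: t a b => [|c t IHt] a b le_ba /=; first by exists [::].
move=> /andP[/andP[gap_ac q_ac] path_t].
have [z] := poly_ivtoo (ltW gap_ac) q_ac.
rewrite in_itv /= => /andP[lt_az lt_zc] root_z.
have [r [size_r path_r all_r]] := IHt c z (ltW lt_zc) path_t.
exists (z :: r); split; rewrite /= ?size_r ?path_r ?root_z //.
by rewrite andbT /gap; lra.
Qed.

(** Let u, v be consecutive zeros of C_n, or u = -1 and v the first zero.  In
    C_(n+1)(t) = t C_n(t - 1) - C_n(t) one of the two terms vanishes at u + 1,
    and the other one vanishes at v, which leaves -C_n(u + 1) and v C_n(v - 1).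
    As u + 1 and v - 1 both lie in the zero-free interval ]u, v[, these values
    have opposite signs.  Past the last zero of C_n the second sign comes from
    C_(n+1) being monic. *)
Lemma charlier_roots (R : rcfType) n :
  exists2 s : seq R, path gap (-1) s &
    charlier R n = \prod_(a <- s) ('X - a%:P).
Proof.
elim: n => [|n [s path_s def_p]]; first by exists [::]; rewrite ?big_nil.
set p := charlier R n in def_p; set q := charlier R n.+1.
have pE x : p.[x] = \prod_(a <- s) (x - a).
  by rewrite def_p horner_prod; apply: eq_bigr => a _; rewrite !hornerE.
have [mon_q size_q] := charlier_monic_size R n.+1.
have [_ size_p] := charlier_monic_size R n.
have size_s : size s = n.
  by move: size_p; rewrite -/p def_p size_prod_XsubC => -[].
have root_s a : a \in s -> p.[a] = 0.
  by move=> s_a; apply/rootP; rewrite def_p root_prod_XsubC.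
(* In (x + 1) C_n(x) - C_n(x + 1) the first term vanishes, either by x + 1 or by
   C_n(x). *)
have q_left x : x \in -1 :: s -> q.[x + 1] = - p.[x + 1].
  rewrite inE hornerS_charlier -/p => /orP[/eqP->|/root_s px0].
    by rewrite addNr mul0r sub0r.
  by rewrite addrK px0 mulr0 sub0r.
have q_right y : y \in s -> q.[y] = y * p.[y - 1].
  by move/root_s => py0; rewrite hornerS_charlier -/p py0 subr0.
have [M0 q_M0] : exists M, forall x, M <= x -> 1 <= q.[x].
  have := @poly_pinfty_gt_lc R q; rewrite (monicP mon_q) ltr01.
  by case=> // M0; exists M0.
set l := last (-1) s.
set M := Num.max M0 (l + 2).
have le_M0 : M0 <= M by rewrite le_max lexx.
have le_lM : l + 2 <= M by rewrite le_max lexx orbT.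
have [||r [size_r path_r all_r]] := @spaced_roots R q (-1) (-1) (rcons s M).
- by [].
- rewrite rcons_path -/l; apply/andP; split.
    apply/(pathP 0) => i lt_i.
    have gap_i := pathP 0 path_s i lt_i; rewrite gap_i /=.
    have s_y := mem_nth 0 lt_i.
    rewrite q_left ?q_right ?mem_nth //=; last by rewrite ltnS ltnW.
    have y_gt0 : 0 < nth 0 s i.
      by have := gap_path_nth_gt path_s lt_i; rewrite -natr1;
         have := @ler0n R i; lra.
    have cut := fun a => @gap_path_cut R _ _ i a path_s lt_i.
    set x := nth 0 (-1 :: s) i in gap_i cut *.
    set y := nth 0 s i in gap_i s_y y_gt0 cut *.
    suff : 0 < p.[x + 1] * p.[y - 1] by nra.
    rewrite !pE -big_split /= big_seq prodr_gt0 // => a /cut.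
    by move: gap_i; rewrite /gap => ? [] ?; nra.
  have gap_M : gap l M by rewrite /gap; lra.
  rewrite gap_M q_left ?mem_last //=.
  have := q_M0 M le_M0; suff : 0 < p.[l + 1] by nra.
  rewrite pE big_seq prodr_gt0 // => a s_a.
  by have := le_last_gap_path path_s s_a; rewrite -/l; lra.
exists r => //.
rewrite -/q (all_roots_prod_XsubC _ all_r).
- by rewrite (monicP mon_q) scale1r.
- by rewrite size_q size_r size_rcons size_s.
rewrite uniq_rootsE; apply: (sorted_uniq lt_trans ltxx).
by move/path_sorted: path_r; apply: sub_sorted => u v /gap_lt.
Qed.

(** * Spectrum of the quotient matrix *)

Lemma eigenvalues_prod_XsubC (R : rcfType) m (A : 'M[R]_m) L :
    char_poly A = \prod_(z <- L) ('X - z%:P) -> sorted >=%R L ->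
  eigenvalues A = L.
Proof.
move=> char_A sorted_L.
apply: (sorted_eq ge_trans ge_anti) => //; first exact: (sort_sorted ge_total).
rewrite /eigenvalues perm_sort -[X in perm_eq _ X]/L.
have char_neq0 : char_poly A != 0 by rewrite monic_neq0 ?char_poly_monic.
apply: perm_trans (perm_count_undup L).
have mupE x : nseq (mup x (char_poly A)) x = nseq (count_mem x L) x.
  by rewrite char_A mu_prod_XsubC.
rewrite (eq_map mupE).
apply/perm_flatten/perm_map/uniq_perm; rewrite ?undup_uniq //.
  exact: polyrcf.uniq_roots.
move=> x; rewrite mem_undup.
have := roots_on_rootsR char_neq0 x; rewrite in_itv /= => <-.
by rewrite char_A root_prod_XsubC.
Qed.

Lemma sum_ord_delta (R : nmodType) m k (c : R) :
  \sum_(j < m) (if j == k :> nat then c else 0) = if (k < m)%N then c else 0.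
Proof. by rewrite -big_mkcond (big_ord1_eq _ (fun=> c)). Qed.

(** The eigenvector is ((-1)^j C_j(t))_j.  Every row but the last one is the
    three-term recurrence.  The last row, having diagonal entry 0 instead of
    n - (n + 1), needs the entry of index n + 1 to equal the one of index n:
    this is C_(n+1)(t) + C_n(t) = 0, that is, t C_n(t - 1) = 0. *)
Lemma stello_quotient_root (R : fieldType) n (t : R) :
  t * (charlier R n).[t - 1] = 0 ->
  root (char_poly (stello_quotient_mx R n)) (n%:R - t).
Proof.
move=> t_root; set A := stello_quotient_mx R n.
have -> : char_poly A = char_poly A^T.
  rewrite /char_poly -det_tr; congr (\det _).
  by apply/matrixP => i j; rewrite !mxE eq_sym.
rewrite -eigenvalue_root_char; apply/eigenvalueP.
pose v j : R := (-1) ^+ j * (charlier R j).[t].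
exists (\row_j v j); last first.
  apply/eqP => /rowP/(_ ord0); rewrite !mxE /v mul1r hornerC => /eqP.
  by rewrite oner_eq0.
have vS j : v j.+1 = (j.+1%:R - t) * v j - j%:R * v j.-1.
  rewrite /v charlier_three_term; case: j => [|j] /=; rewrite ?exprS; ring.
apply/rowP => l; rewrite !mxE.
have le_ln : (l <= n)%N by rewrite -ltnS.
(* For l = 0 the third summand is 0 * v 0, hence harmless. *)
rewrite (eq_bigr (fun j : 'I_n.+1 =>
    (if j == l :> nat
     then (if (l < n)%N then n%:R - l.+1%:R else 0) * v l else 0)
  + (if j == l.+1 :> nat then v l.+1 else 0)
  + (if j == l.-1 :> nat then l%:R * v l.-1 else 0))); last first.
  move=> j _; rewrite !mxE.
  case: (eqVneq (j : nat) l) => [jl|].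
    rewrite jl mulrC; have -> : (l == l.+1 :> nat) = false by lia.
    case: eqP => l0; last by rewrite !addr0.
    have l_eq0 : nat_of_ord l = 0%N by lia.
    by rewrite [in l%:R * _]l_eq0 mul0r !addr0.
  move=> neq_jl; case: (eqVneq (j : nat) l.+1) => [->|neq_jl1].
    have -> : (l.+1 == l.-1) = false by lia.
    by rewrite mulr1 add0r addr0.
  rewrite !add0r; case: (eqVneq (j : nat) l.-1) => jl.
    have -> : (l == j.+1 :> nat) by lia.
    have <- : j.+1 = l by lia.
    by rewrite mulrC.
  have -> : (l == j.+1 :> nat) = false by lia.
  by rewrite mulr0.
rewrite !big_split /= !sum_ord_delta ltn_ord ltnS
  (leq_ltn_trans (leq_pred _)) //.
have [lt_ln|le_nl] := ltnP l n.
  rewrite vS -natr1; ring.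
have -> : (l : nat) = n by lia.
have vS_n : v n.+1 = v n.
  by rewrite /v hornerS_charlier t_root exprS; ring.
have -> : n%:R * v n.-1 = (n.+1%:R - t) * v n - v n.
  by rewrite -[X in _ = _ - X]vS_n vS; ring.
rewrite -natr1; ring.
Qed.

Lemma stello_quotient_spectrum (R : rcfType) n (s : seq R) :
    path gap (-1) s -> charlier R n = \prod_(a <- s) ('X - a%:P) ->
  eigenvalues (stello_quotient_mx R n) = n%:R :: [seq n%:R - 1 - a | a <- s].
Proof.
move=> path_s def_p; set L := _ :: _.
have size_s : size s = n.
  have [_] := charlier_monic_size R n.
  by rewrite def_p size_prod_XsubC => -[].
have sorted_L : sorted >%R L.
  have -> : L = [seq n%:R - 1 - a | a <- -1 :: s].
    by rewrite /L /= opprK subrK.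
  apply: (@homo_sorted _ _ _ gap _ _ (-1 :: s)) path_s => u v /gap_lt.
  by rewrite /= ltrD2l ltrN2.
apply: eigenvalues_prod_XsubC; last first.
  by apply: sub_sorted sorted_L => u v /ltW.
rewrite [LHS](@all_roots_prod_XsubC _ _ L).
- by rewrite (monicP (char_poly_monic _)) scale1r.
- by rewrite size_char_poly /= size_map size_s.
- rewrite /= -[X in root _ X]subr0 stello_quotient_root ?mul0r //=.
  apply/allP => _ /mapP[a s_a ->].
  rewrite -addrA -opprD stello_quotient_root // [1 + a]addrC addrK.
  have -> : (charlier R n).[a] = 0.
    by apply/rootP; rewrite def_p root_prod_XsubC.
  by rewrite mulr0.
rewrite uniq_rootsE -rev_uniq; apply: (sorted_uniq lt_trans ltxx).
by rewrite rev_sorted.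
Qed.

(** * Position of the smallest zeros *)

(** The k + 1 intervals ]j, j + 1[ all contain a zero, and the zero of index j
    is larger than j, so by induction the zero in ]k, k + 1[ has index at least
    k. *)
Lemma spaced_root_in (R : rcfType) (p : {poly R}) s k :
    path gap (-1) s -> p = \prod_(a <- s) ('X - a%:P) ->
    (forall j, (j <= k)%N -> p.[j%:R] * p.[j.+1%:R] < 0) ->
  (k < size s)%N /\ k%:R < nth 0 s k < k.+1%:R.
Proof.
move=> path_s def_p.
have nth_gt j : (j < size s)%N -> j%:R < nth 0 s j.
  by move/(gap_path_nth_gt path_s); rewrite -natr1; lra.
have root_in j : p.[j%:R] * p.[j.+1%:R] < 0 ->
    exists2 l, (l < size s)%N & j%:R < nth 0 s l < j.+1%:R.
  have le_j : j%:R <= j.+1%:R :> R by rewrite ler_nat.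
  move/(poly_ivtoo le_j) => [z]; rewrite in_itv /= => z_in.
  rewrite def_p root_prod_XsubC => /(nthP 0)[l lt_l def_z].
  by exists l; rewrite ?def_z.
have mono i l : (i <= l < size s)%N -> nth 0 s i <= nth 0 s l.
  exact: (@gap_path_mono _ (-1) s i.+1 l.+1).
elim: k => [|k IHk] alt;
  have [l lt_l /andP[gt_l l_lt]] := root_in _ (alt _ (leqnn _)).
  have lt_0 := leq_ltn_trans (leq0n l) lt_l.
  by rewrite nth_gt // (le_lt_trans (mono 0%N l lt_l) l_lt).
have [|lt_k /andP[_ k_lt]] := IHk; first by move=> j /leqW; exact: alt.
have lt_kl : (k < l)%N.
  rewrite ltnNge; apply/negP => le_lk.
  by have := mono l k; rewrite le_lk => /(_ lt_k); lra.
have lt_k1 := leq_ltn_trans lt_kl lt_l.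
rewrite nth_gt // (le_lt_trans (mono k.+1 l _) l_lt) //.
by rewrite lt_kl.
Qed.

(** For a fixed natural number k, the value C_n(k) is (-1)^n times a polynomial
    in n; this is how that polynomial changes from k to k + 1. *)
Lemma charlier_next_value (R : comNzRingType) (x : R) (q : R -> R) :
    (forall n, (charlier R n).[x] = (-1) ^+ n * q n%:R) ->
  forall n, (charlier R n).[x + 1] =
    (-1) ^+ n * (q n%:R - n%:R * q (n%:R - 1)).
Proof.
move=> val_x n; rewrite charlier_shift addrK !val_x.
case: n => [|n] /=; first by rewrite !mul0r addr0 subr0.
by rewrite -natr1 addrK exprS; ring.
Qed.

Lemma charlier_values (R : comNzRingType) n (x := n%:R : R) :
  [/\ (charlier R n).[0%:R] = (-1) ^+ n,
      (charlier R n).[1%:R] = (-1) ^+ n * (1 - x),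
      (charlier R n).[2%:R] = (-1) ^+ n * (x ^+ 2 - 3 * x + 1),
      (charlier R n).[3%:R] =
        (-1) ^+ n * (- x ^+ 3 + 6 * x ^+ 2 - 8 * x + 1)
    & (charlier R n).[4%:R] =
        (-1) ^+ n * (x ^+ 4 - 10 * x ^+ 3 + 29 * x ^+ 2 - 24 * x + 1)].
Proof.
have val0 m : (charlier R m).[0%:R] = (-1) ^+ m * 1.
  elim: m => [|m IHm]; first by rewrite /= hornerE mul1r.
  by rewrite hornerS_charlier IHm exprS; ring.
have val1 := charlier_next_value (q := fun=> 1) val0.
have val2 := charlier_next_value (q := fun y => 1 - y * 1) val1.
have val3 := charlier_next_value
  (q := fun y => 1 - y * 1 - y * (1 - (y - 1) * 1)) val2.
have val4 := charlier_next_value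
  (q := fun y => 1 - y * 1 - y * (1 - (y - 1) * 1)
    - y * (1 - (y - 1) * 1 - (y - 1) * (1 - (y - 1 - 1) * 1))) val3.
rewrite !natr1 in val1 val2 val3 val4.
by split; rewrite ?val0 ?val1 ?val2 ?val3 ?val4 /x; ring.
Qed.

(** The first thresholds are the least n with n > 1 and n^2 - 3 n + 1 > 0; the
    cubic and the quartic still have the wrong sign at n = 4 and n = 5. *)
Lemma charlier_sign_change (R : realFieldType) n j :
    (j < 4)%N -> (nth 0 [:: 2; 3; 5; 6] j <= n)%N ->
  (charlier R n).[j%:R] * (charlier R n).[j.+1%:R] < 0.
Proof.
have [c0 c1 c2 c3 c4] := charlier_values R n.
have signK (a b : R) : (-1) ^+ n * a * ((-1) ^+ n * b) = a * b.
  by rewrite mulrACA -expr2 sqrr_sign mul1r.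
have le_nat m : (m <= n)%N -> m%:R <= n%:R :> R by rewrite ler_nat.
case: j => [|[|[|[|//]]]] _ /= /le_nat; rewrite ?c0 ?c1 ?c2 ?c3 ?c4.
- by rewrite -[X in X * _]mulr1 signK; lra.
- by rewrite signK => le_x; rewrite nmulr_rlt0; nra.
- rewrite signK; set x := n%:R => le_x.
  have q2 : 0 < x ^+ 2 - 3 * x + 1 by nra.
  have q3 : - x ^+ 3 + 6 * x ^+ 2 - 8 * x + 1 < 0.
    (* Expanded in powers of x - 5, all its coefficients are negative. *)
    rewrite -subr_ge0 in le_x.
    by have := exprn_ge0 2 le_x; have := exprn_ge0 3 le_x; lra.
  by rewrite pmulr_rlt0.
- rewrite signK; set x := n%:R => le_x.
  (* Expanded in powers of x - 6, both polynomials have coefficients of a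
     constant sign. *)
  have y_ge0 : 0 <= x - 6 by rewrite subr_ge0.
  have := exprn_ge0 2 y_ge0; have := exprn_ge0 3 y_ge0.
  have := exprn_ge0 4 y_ge0 => y4 y3 y2.
  have q3 : - x ^+ 3 + 6 * x ^+ 2 - 8 * x + 1 < 0 by lra.
  have q4 : 0 < x ^+ 4 - 10 * x ^+ 3 + 29 * x ^+ 2 - 24 * x + 1 by lra.
  by rewrite nmulr_rlt0.
Qed.

Theorem theorem8 (R : rcfType) (n i : nat) (n_gt1 : (1 < n)%N)
  (i_range : (1 <= i <= 5)%N) (i_index : (i <= n.+1)%N)
  (not_exceptional :
    (n, i) \notin [:: (2, 3); (3, 4); (4, 4); (4, 5); (5, 5)]%N) :
  nth_largest_eigenvalue (stello_quotient_mx R n) i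
    \in `]n%:R - i%:R, n%:R - i%:R + 1].
Proof.
have [s path_s def_p] := charlier_roots R n.
rewrite /nth_largest_eigenvalue (stello_quotient_spectrum path_s def_p).
rewrite in_itv /=.
case: i i_range i_index not_exceptional => [|[|k]] //= k_range k_index not_exc.
  lra.
have [|lt_k /andP[k_lt lt_k1]] := spaced_root_in (k := k) path_s def_p.
  move=> j le_jk; apply: charlier_sign_change; first by lia.
  move: not_exc; rewrite !inE !xpair_eqE.
  by case: k j le_jk k_range k_index => [|[|[|[|//]]]] [|[|[|[|//]]]] //=; lia.
rewrite (nth_map 0) // -!natr1; rewrite -natr1 in lt_k1; lra.
Qed.
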